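(* Let $f\colon\mathbb{B}^n\to\mathbb{B}^n$ be a Boolean network with set of components $V$, let $v\in V$ be such that there is no positive loop at $v$ in $G(f)$, and let $\tilde f$ be the network obtained by eliminating $v$ (with $\mathcal{R}^0,\mathcal{R}^1,\mathcal{S}^0,\mathcal{S}^1,\pi$ as in the context). Then: (i) if $x\in\mathbb{B}^n$ is a fixed point for $f$, then $x=\mathcal{R}^0(x)=\mathcal{R}^1(x)$, $\pi(x)$ is a fixed point for $\tilde f$, and no other fixed point for $f$ is projected on $\pi(x)$; (ii) if $\{x,\bar{x}^v\}$ is a cyclic attractor of $AD(f)$, then $\pi(x)$ is a fixed point for $\tilde f$; (iii) if $x\in\mathbb{B}^{n-1}$ is a fixed point for $\tilde f$, then $\{\mathcal{S}^0(x),\mathcal{S}^1(x)\}$ is an attractor of $AD(f)$; (iv) if $T\subseteq\mathbb{B}^n$ is a trap set for $f$, then $\pi(T)$ is a trap set for $\tilde f$; (v) if $\{x,\bar{x}^i\}$ is a cyclic attractor of $AD(f)$ for some $x\in\mathbb{B}^n$ and $i\neq v$, then $\{\pi(x),\pi(\bar{x}^i)\}$ is a cyclic attractor of $AD(\tilde f)$; (vi) if $\tilde A\subseteq\mathbb{B}^{n-1}$ is an attractor of $AD(\tilde f)$, there exists at most one attractor of $AD(f)$ intersecting $\pi^{-1}(\tilde A)$.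
   Context: $\mathbb{B}=\{0,1\}$. A Boolean network is a map $f\colon\mathbb{B}^n\to\mathbb{B}^n$ with set of components $V=\{1,\dots,n\}$. For $x\in\mathbb{B}^n$ and $I\subseteq V$, $\bar{x}^I$ flips exactly the components in $I$; $\bar{x}^i=\bar{x}^{\{i\}}$; $x^{i=a}$ is $x$ with $i$-th component set to $a$. The asynchronous dynamics $AD(f)$ is the directed graph on $\mathbb{B}^n$ with a transition $x\to\bar{x}^i$ iff $f_i(x)\neq x_i$. The interaction graph $G(f)$ is the signed multidigraph on $V$ with an edge $j\to i$ of sign $s\in\{-1,1\}$ iff $s=(f_i(\bar{x}^j)-f_i(x))(\bar{x}^j_j-x_j)$ for some $x\in\mathbb{B}^n$; a positive loop at $v$ is an edge $v\to v$ of sign $+1$. A trap set is a set $T$ of states such that every transition from a state of $T$ ends in $T$; attractors are the minimal (w.r.t. inclusion) nonempty trap sets; an attractor is a fixed point (identified with its unique state $x$, i.e. $f(x)=x$) if it has one state, cyclic otherwise. Elimination of $v$ (no positive loop at $v$): for $a\in\{0,1\}$, $\mathcal{R}^a(x)=(x_1,\dots,x_{v-1},f_v(x^{v=a}),x_{v+1},\dots,x_n)$; $\pi\colon\mathbb{B}^n\to\mathbb{B}^{n-1}$ is the projection onto components $V\setminus\{v\}$ (which index $\mathbb{B}^{n-1}$); $\mathcal{S}^a\colon\mathbb{B}^{n-1}\to\mathbb{B}^n$ is the unique map with $\mathcal{S}^a\circ\pi=\mathcal{R}^a$; $\tilde f\colon\mathbb{B}^{n-1}\to\mathbb{B}^{n-1}$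 is given for $i\neq v$ by $\tilde f_i(x)=f_i(\mathcal{S}^0(x))\wedge f_i(\mathcal{S}^1(x))$ if $x_i=1$ and $\tilde f_i(x)=f_i(\mathcal{S}^0(x))\vee f_i(\mathcal{S}^1(x))$ if $x_i=0$. *)

(* Defs.v *)
From HB Require Import structures.
From mathcomp Require Import all_boot all_order all_algebra.

Set Implicit Arguments.
Unset Strict Implicit.
Unset Printing Implicit Defensive.

Import GRing.Theory.
Local Open Scope ring_scope.

(* Components range over an arbitrary finite type, so that the same notions   *)
(* apply to f, with components 'I_n, and to the network obtained by           *)
(* eliminating v, with components {i : 'I_n | i != v}.                        *)
Definition state (V : finType) := {ffun V -> bool}.

Section BooleanNetworks.
Variable V : finType.
Implicit Types (f : state V -> state V) (x y : state V) (i j v : V).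
Implicit Types (I : {set V}) (T A : {set state V}).

Definition flip x I : state V := [ffun i => if i \in I then ~~ x i else x i].

Definition set_comp x i (a : bool) : state V :=
  [ffun j => if j == i then a else x j].

Definition AD f : rel (state V) :=
  fun x y => [exists i, (f x i != x i) && (y == flip x [set i])].

Definition interaction_edge f j i (s : int) : bool :=
  (s \in [:: -1; 1]) &&
  [exists x : state V,
     s == ((f (flip x [set j]) i)%:R - (f x i)%:R)
          * ((flip x [set j] j)%:R - (x j)%:R)].

Definition positive_loop f v : bool := interaction_edge f v v 1.

Definition fixed_point f x : Prop := f x = x.

Definition trap_set f T : bool :=
  [forall x in T, forall y, AD f x y ==> (y \in T)].

Definition attractor f A : bool :=
  minset (fun T => (T != set0) && trap_set f T) A.

Definition cyclic_attractor f A : bool := attractor f A && (#|A| != 1)%N.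

End BooleanNetworks.

Section Elimination.
Variables (V : finType) (v : V).

Definition others : finType := {i : V | i != v}.

Definition proj (x : state V) : state others := [ffun i => x (val i)].

Definition extend (a : bool) (y : state others) : state V :=
  [ffun i => if insub i is Some j then y j else a].

Variable f : state V -> state V.

Definition elimR (a : bool) (x : state V) : state V :=
  set_comp x v (f (set_comp x v a) v).

(* The value that extend puts at v is immaterial; elimS_proj and elimS_unique *)
(* show that elimS a is the unique map with elimS a \o proj = elimR a.        *)
Definition elimS (a : bool) (y : state others) : state V :=
  elimR a (extend a y).

Definition eliminate (y : state others) : state others :=
  [ffun i => if y i
             then f (elimS false y) (val i) && f (elimS true y) (val i)
             else f (elimS false y) (val i) || f (elimS true y) (val i)].

Lemma extendK a : cancel (extend a) proj.
Proof. by move=> y; apply/ffunP => i; rewrite !ffunE valK. Qed.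

Lemma set_comp_extend a b x : set_comp (extend a (proj x)) v b = set_comp x v b.
Proof.
apply/ffunP => i; rewrite !ffunE; case: eqVneq => // ne_iv.
by case: insubP => [j _ <-|]; rewrite ?ffunE ?ne_iv.
Qed.

Lemma elimS_proj a x : elimS a (proj x) = elimR a x.
Proof. by rewrite /elimS /elimR !set_comp_extend. Qed.

Lemma elimS_unique a (S : state others -> state V) :
  (forall x, S (proj x) = elimR a x) -> S =1 elimS a.
Proof. by move=> SE y; rewrite -(extendK a y) SE elimS_proj. Qed.

End Elimination.

(* Main.v *)
(* Absence of a positive loop at v means that elimR v f a x is x or its
   successor in direction v. Hence every trap set meeting the fibre of proj v
   over y contains both elimS f false y and elimS f true y, while eliminate f
   can change i at y exactly when f can change i at one of these two states.
   Trap sets therefore project to trap sets, and two trap sets whose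
   projections meet must themselves meet. *)

Require Import Defs.
From mathcomp Require Import all_boot all_order all_algebra.

Set Implicit Arguments.
Unset Strict Implicit.
Unset Printing Implicit Defensive.

(** * Trap sets and attractors of a single network *)

Section TrapSets.
Variables (V : finType) (f : state V -> state V).
Implicit Types (x y : state V) (T A B : {set state V}).

Lemma trap_setP T :
  reflect (forall x i, x \in T -> f x i != x i -> flip x [set i] \in T)
          (trap_set f T).
Proof.
apply: (iffP forall_inP) => [trT x i xT fxi | trT x xT].
  have /forallP/(_ (flip x [set i]))/implyP := trT x xT; apply.
  by apply/existsP; exists i; rewrite fxi eqxx.
apply/forallP => y; apply/implyP => /existsP[i /andP[fxi /eqP->]].
exact: trT.
Qed.

Lemma trap_setI A B : trap_set f A -> trap_set f B -> trap_set f (A :&: B).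
Proof.
move=> /trap_setP trA /trap_setP trB; apply/trap_setP => x i.
by rewrite !inE => /andP[xA xB] fxi; rewrite trA ?trB.
Qed.

Lemma flip1_neq x i : flip x [set i] != x.
Proof. by apply/eqP => /ffunP/(_ i); rewrite ffunE set11; case: (x i). Qed.

(** Lets results about trap sets specialise to fixed points. *)
Lemma trap_set1 x : reflect (fixed_point f x) (trap_set f [set x]).
Proof.
apply: (iffP (trap_setP _)) => [tr | fx y i /set1P->]; last first.
  by rewrite fx eqxx.
apply/ffunP => i; apply/eqP; apply: contraT => fxi.
by have /set1P/eqP := tr x i (set11 x) fxi; rewrite (negPf (flip1_neq x i)).
Qed.

Lemma attractorP A :
  reflect [/\ A != set0, trap_set f A &
             forall T, T != set0 -> trap_set f T -> T \subset A -> T = A]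
          (attractor f A).
Proof.
apply: (iffP minsetP) => [[/andP[A0 trA] minA] | [A0 trA minA]].
  by split=> // T T0 trT; apply: minA; rewrite T0.
by split=> [|T /andP[T0 trT]]; [rewrite A0 | apply: minA].
Qed.

(** The intersection is a nonempty trap set inside [A], so minimality forces it to be [A]. *)
Lemma attractor_sub_trap A T :
  attractor f A -> trap_set f T -> A :&: T != set0 -> A \subset T.
Proof.
move=> /attractorP[_ trA minA] trT AT0; apply/setIidPl.
by apply: minA (subsetIl A T) => //; apply: trap_setI.
Qed.

Lemma attractor_eq A B :
  attractor f A -> attractor f B -> A :&: B != set0 -> A = B.
Proof.
move=> atA atB AB0; have [_ trA _] := attractorP _ atA.
have [_ trB _] := attractorP _ atB; apply/eqP; rewrite eqEsubset.
by rewrite !attractor_sub_trap // setIC.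
Qed.

End TrapSets.

(** * Lifting and projecting dynamics along the elimination of [v] *)

Section Elimination.
Variables (V : finType) (v : V) (f : state V -> state V).
Implicit Types (x : state V) (y : state (others v)) (T : {set state V}).

Lemma proj_set_comp x a : proj v (set_comp x v a) = proj v x.
Proof. by apply/ffunP => i; rewrite !ffunE (negPf (valP i)). Qed.

Lemma proj_elimR a x : proj v (elimR v f a x) = proj v x.
Proof. exact: proj_set_comp. Qed.

Lemma proj_elimS a y : proj v (elimS f a y) = y.
Proof. by rewrite proj_elimR extendK. Qed.

Lemma elimS_val a y (i : others v) : elimS f a y (val i) = y i.
Proof. by rewrite -[in RHS](proj_elimS a y) [RHS]ffunE. Qed.

Lemma proj_flipv x : proj v (flip x [set v]) = proj v x.
Proof. by apply/ffunP => i; rewrite !ffunE inE (negPf (valP i)). Qed.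

Lemma proj_flip x (i : others v) :
  proj v (flip x [set val i]) = flip (proj v x) [set i].
Proof. by apply/ffunP => j; rewrite !ffunE !inE val_eqE. Qed.

(** A conjunction leaves the value 1, and a disjunction the value 0, as soon as one of its two
    arguments does. *)
Lemma eliminate_neq y (i : others v) :
  (eliminate f y i != y i) = [exists a, f (elimS f a y) (val i) != y i].
Proof.
have -> : [exists a, f (elimS f a y) (val i) != y i] =
    (f (elimS f false y) (val i) != y i) || (f (elimS f true y) (val i) != y i).
  apply/existsP/orP => [[[]]|[]] ?; [by right | by left | |].
    by exists false.
  by exists true.
by rewrite ffunE; case: (y i); do 2![case: (f _ _)].
Qed.

Lemma set_comp_id x : set_comp x v (x v) = x.
Proof. by apply/ffunP => i; rewrite ffunE; case: eqP => // ->. Qed.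

Lemma set_comp_negb x : set_comp x v (~~ x v) = flip x [set v].
Proof. by apply/ffunP => i; rewrite !ffunE inE; case: eqP => // ->. Qed.

Hypothesis no_positive_loop : ~~ positive_loop f v.

(** If [f] at [v] rose from 0 to 1 together with component [v], the state with 0 at [v] would
    witness a loop of sign (1-0)(1-0) = 1. *)
Lemma no_positive_loop_leq x :
  f (set_comp x v true) v -> f (set_comp x v false) v.
Proof.
move=> ft; apply: contraNT no_positive_loop => ff.
rewrite /positive_loop /interaction_edge !inE eqxx orbT /=.
apply/existsP; exists (set_comp x v false).
have ->: flip (set_comp x v false) [set v] = set_comp x v true.
  by apply/ffunP => i; rewrite !ffunE inE; case: eqP.
by rewrite ft (negPf ff) !ffunE eqxx.
Qed.

(** The case [a = x v] is immediate. Otherwise the new value at [v] is [a] itself, and since [f] at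
    [v] is nonincreasing in component [v], it also takes the value [a] at [x]. *)
Lemma elimR_step a x : elimR v f a x != x ->
  f x v != x v /\ elimR v f a x = flip x [set v].
Proof.
have := @no_positive_loop_leq x.
rewrite /elimR -set_comp_negb; move: (set_comp_id x).
case: a; case: (x v) => xE; rewrite /= ?xE.
all: case Et: (f _ v); case Ef: (f _ v); rewrite ?xE ?eqxx //.
all: try by move=> /(_ isT).
Qed.

Lemma trap_elimR T a x : trap_set f T -> x \in T -> elimR v f a x \in T.
Proof.
move=> /trap_setP trT xT.
have [-> // | /elimR_step[fxv ->]] := eqVneq (elimR v f a x) x.
exact: trT.
Qed.

Lemma trap_elimS T a x : trap_set f T -> x \in T -> elimS f a (proj v x) \in T.
Proof. by rewrite elimS_proj; apply: trap_elimR. Qed.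

(** A transition at [proj v x] comes from one at some [elimS f a (proj v x)], a state that lies in
    [T] along with [x]. *)
Lemma trap_proj T : trap_set f T -> trap_set (eliminate f) (proj v @: T).
Proof.
move=> trT; apply/trap_setP => _ i /imsetP[x xT ->].
rewrite eliminate_neq => /existsP[a fai].
rewrite -(proj_elimS a (proj v x)) -proj_flip imset_f //.
by apply: (trap_setP _ _ trT); rewrite ?trap_elimS ?elimS_val.
Qed.

(** Let g(c) be the value of [f] at [v] when [v] is set to c and the rest is [y]. Instability says
    g(g(a)) differs from g(a), so g(a) is not [a]; hence g swaps the two values. *)
Lemma elimS_flipv a y : f (elimS f a y) v != elimS f a y v ->
  flip (elimS f a y) [set v] = elimS f (~~ a) y.
Proof.
rewrite -set_comp_negb /elimS /elimR; set z := extend a y.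
(* The filler value at [v] is overwritten, so all states can be expressed through [z]. *)
have zE b : set_comp (extend b y) v =1 set_comp z v.
  by move=> c; rewrite -(extendK a y) set_comp_extend.
have set2 b c : set_comp (set_comp z v b) v c = set_comp z v c.
  by apply/ffunP => i; rewrite !ffunE; case: eqP.
rewrite !zE set2 ffunE eqxx.
case: (eqVneq (f (set_comp z v a) v) a) => [E | ca]; first by rewrite !E eqxx.
have {ca} -> : f (set_comp z v a) v = ~~ a.
  by move: ca; case: (f _ v); case: (a).
by rewrite negbK; case: (f _ v); case: (a).
Qed.

(** Direction [v] can only swap the two states, and any other transition would move [y]. For
    minimality, both states project to [y], so a trap set containing one contains the other. *)
Lemma eliminate_fixed_attractor y : fixed_point (eliminate f) y ->
  attractor f [set elimS f false y; elimS f true y].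
Proof.
move=> fy.
have in2 a : elimS f a y \in [set elimS f false y; elimS f true y].
  by case: a; rewrite !inE eqxx ?orbT.
have in2P x : x \in [set elimS f false y; elimS f true y] ->
    exists a, x = elimS f a y.
  by case/set2P => ->; [exists false | exists true].
apply/attractorP; split.
- by apply/set0Pn; exists (elimS f false y).
- apply/trap_setP => _ i /in2P[a ->].
  have [->/elimS_flipv-> // | iv fai] := eqVneq i v.
  have: eliminate f y (Sub i iv) != y (Sub i iv).
    by rewrite eliminate_neq; apply/existsP; exists a; rewrite -(elimS_val a).
  by rewrite fy eqxx.
- move=> T /set0Pn[x xT] trT sT2; apply/eqP; rewrite eqEsubset sT2.
  have [a xE] := in2P x (subsetP sT2 x xT).
  apply/subsetP => _ /in2P[b ->].
  by rewrite -(proj_elimS a y) -xE trap_elimS.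
Qed.

Lemma proj_fixed_point x :
  fixed_point f x -> fixed_point (eliminate f) (proj v x).
Proof. by move=> /trap_set1/trap_proj; rewrite imset_set1 => /trap_set1. Qed.

Lemma fixed_point_elimR a x : fixed_point f x -> elimR v f a x = x.
Proof. by move=> /trap_set1/trap_elimR-/(_ a x (set11 x))/set1P. Qed.

(** A fixed point is recovered from its projection by [elimS]. *)
Lemma fixed_point_proj_inj x x' :
  fixed_point f x -> fixed_point f x' -> proj v x' = proj v x -> x' = x.
Proof.
move=> fx fx' exx; rewrite -(fixed_point_elimR false fx') -elimS_proj exx.
by rewrite elimS_proj fixed_point_elimR.
Qed.

Lemma proj_attractor_flipv x : attractor f [set x; flip x [set v]] ->
  fixed_point (eliminate f) (proj v x).
Proof.
move=> /attractorP[_ /trap_proj + _].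
by rewrite imsetU1 imset_set1 proj_flipv setUid => /trap_set1.
Qed.

(** [A] meets the attractor formed by the two lifts of [proj v x], hence equals it. *)
Lemma attractor_proj_fixed A x : attractor f A -> x \in A ->
  fixed_point (eliminate f) (proj v x) -> proj v @: A = [set proj v x].
Proof.
move=> atA xA /eliminate_fixed_attractor atS.
have [_ trA _] := attractorP _ _ atA.
rewrite (attractor_eq atA atS) ?imsetU1 ?imset_set1 ?proj_elimS ?setUid //.
apply/set0Pn; exists (elimS f false (proj v x)).
by rewrite inE trap_elimS // !inE eqxx.
Qed.

Lemma proj_attractor_flip x (i : others v) :
  attractor f [set x; flip x [set val i]] ->
  cyclic_attractor (eliminate f) [set proj v x; proj v (flip x [set val i])].
Proof.
set x' := flip x _ => atA; set A := [set x; x'] in atA.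
have AE : proj v @: A = [set proj v x; proj v x'] by rewrite imsetU1 imset_set1.
have nxx' : proj v x != proj v x' by rewrite proj_flip eq_sym flip1_neq.
rewrite -AE; have card2 : #|proj v @: A| = 2 by rewrite AE cards2 nxx'.
apply/andP; split; last by rewrite card2.
have [A0 trA _] := attractorP _ _ atA.
apply/attractorP; split=> [||T T0 trT sTA]; first by rewrite -card_gt0 card2.
  exact: trap_proj.
apply/eqP; rewrite eqEcard sTA card2 ltnNge; apply/negP => leT1.
have /cards1P[y Ty] : #|T| == 1 by rewrite eqn_leq leT1 card_gt0.
have /imsetP[z zA yE] : y \in proj v @: A by rewrite (subsetP sTA) // Ty set11.
have fz : fixed_point (eliminate f) (proj v z).
  by apply/trap_set1; rewrite -yE -Ty.
by move: card2; rewrite (attractor_proj_fixed atA zA fz) cards1.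
Qed.

(** Both projections are trap sets meeting [A'], so they cover it. Any [y] in [A'] then has a
    preimage in each attractor, which puts [elimS f false y] in both. *)
Lemma attractor_proj_uniq (A' : {set state (others v)}) (A B : {set state V}) :
  attractor (eliminate f) A' ->
  attractor f A -> A :&: (proj v @^-1: A') != set0 ->
  attractor f B -> B :&: (proj v @^-1: A') != set0 -> A = B.
Proof.
move=> atA' atA AA' atB BA'.
have sub C : attractor f C -> C :&: (proj v @^-1: A') != set0 ->
    trap_set f C /\ A' \subset proj v @: C.
  move=> /attractorP[_ trC _] /set0Pn[x /setIP[xC]]; rewrite inE => xA'.
  split=> //; apply: attractor_sub_trap (trap_proj trC) _ => //.
  by apply/set0Pn; exists (proj v x); rewrite inE xA' imset_f.
have [[trA sA] [trB sB]] := (sub A atA AA', sub B atB BA').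
have [/set0Pn[y yA'] _ _] := attractorP _ _ atA'.
have /imsetP[a aA ya] := subsetP sA y yA'.
have /imsetP[b bB yb] := subsetP sB y yA'.
apply: (attractor_eq atA atB); apply/set0Pn; exists (elimS f false y).
by rewrite inE {1}ya yb !trap_elimS.
Qed.

End Elimination.

Theorem theorem3p3 (n : nat) (f : state 'I_n -> state 'I_n) (v : 'I_n)
    (no_positive_loop : ~~ positive_loop f v) :
  (* (i) *)
  (forall x : state 'I_n, fixed_point f x ->
     [/\ x = elimR v f false x,
         x = elimR v f true x,
         fixed_point (eliminate f) (proj v x) &
         forall y : state 'I_n,
           fixed_point f y -> proj v y = proj v x -> y = x]) /\
  (* (ii) *)
  (forall x : state 'I_n, cyclic_attractor f [set x; flip x [set v]] ->
     fixed_point (eliminate f) (proj v x)) /\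
  (* (iii) *)
  (forall x : state (others v), fixed_point (eliminate f) x ->
     attractor f [set elimS f false x; elimS f true x]) /\
  (* (iv) *)
  (forall T : {set state 'I_n}, trap_set f T ->
     trap_set (eliminate f) (proj v @: T)) /\
  (* (v) *)
  (forall (x : state 'I_n) (i : 'I_n), i != v ->
     cyclic_attractor f [set x; flip x [set i]] ->
     cyclic_attractor (eliminate f) [set proj v x; proj v (flip x [set i])]) /\
  (* (vi) *)
  (forall A' : {set state (others v)}, attractor (eliminate f) A' ->
     forall A B : {set state 'I_n},
       attractor f A -> A :&: (proj v @^-1: A') != set0 ->
       attractor f B -> B :&: (proj v @^-1: A') != set0 -> A = B).
Proof.
split=> [x fx|].
  split; rewrite ?fixed_point_elimR //; first exact: proj_fixed_point.
  by move=> y; apply: fixed_point_proj_inj.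
split=> [x /andP[atA _]|]; first exact: proj_attractor_flipv.
split; first exact: eliminate_fixed_attractor.
split; first exact: trap_proj.
split=> [x i iv /andP[atA _]|A' atA' A B].
  exact: (@proj_attractor_flip _ v f no_positive_loop x (Sub i iv)).
exact: attractor_proj_uniq.
Qed.
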